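(* Let $d,n,q\ge 1$ be integers. There exist an embedding matrix $W_E\in\mathbb{R}^{3d\times(d+1)}$ and a single linear-attention transformer layer $\mathsf{TF}_1$ with $h=d$ heads and hidden dimension $d_{\mathsf{hid}}=3d$ (i.e. matrices $W_{V_i},W_{K_i},W_{Q_i}\in\mathbb{R}^{3\times 3d}$ for $i=1,\dots,d$ and $W_1\in\mathbb{R}^{3d\times 3d}$), not depending on the data, such that for all $x_1,\dots,x_{n+q}\in\mathbb{R}^d$ and $y_1,\dots,y_n\in\mathbb{R}$, with input $$E=\begin{pmatrix}x_1&\cdots&x_n&x_{n+1}&\cdots&x_{n+q}\\ y_1&\cdots&y_n&0&\cdots&0\end{pmatrix}\in\mathbb{R}^{(d+1)\times(n+q)},$$ the output $H^{(1)}=\mathsf{TF}_1(W_EE)\in\mathbb{R}^{3d\times(n+q)}$ has the form $$H^{(1)}=\begin{pmatrix}\tilde x_1&\cdots&\tilde x_n&\tilde x_{n+1}&\cdots&\tilde x_{n+q}\\ y_1&\cdots&y_n&0&\cdots&0\\ *&\cdots&*&*&\cdots&*\end{pmatrix},$$ where the entries $*$ (rows $d+2,\dots,3d$) are arbitrary and, for $k=1,\dots,n+q$, $\tilde x_k=\hat R x_k$ with $\hat R=\mathrm{diag}(\hat r_1,\dots,\hat r_d)$ and $\hat r_j=\frac1n\sum_{i=1}^n x_{ij}y_i$ ($x_{ij}$ being the $j$-th coordinate of $x_i$).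
   Context: A linear-attention transformer layer with $h$ heads and hidden dimension $d_{\mathsf{hid}}$ (divisible by $h$), acting on $H\in\mathbb{R}^{d_{\mathsf{hid}}\times m}$ with $m=n+q$, is the map $$\mathsf{TF}(H)=W_1\Big(H+\mathsf{Concat}\big[V_1MK_1^\top Q_1,\dots,V_hMK_h^\top Q_h\big]\Big),$$ where $V_i=W_{V_i}H$, $K_i=W_{K_i}H$, $Q_i=W_{Q_i}H$, the parameters are $W_{V_i},W_{K_i},W_{Q_i}\in\mathbb{R}^{(d_{\mathsf{hid}}/h)\times d_{\mathsf{hid}}}$ and $W_1\in\mathbb{R}^{d_{\mathsf{hid}}\times d_{\mathsf{hid}}}$, $\mathsf{Concat}$ stacks the $h$ matrices of size $(d_{\mathsf{hid}}/h)\times m$ vertically into a $d_{\mathsf{hid}}\times m$ matrix, and $M=\begin{pmatrix}I_n&0\\0&0\end{pmatrix}\in\mathbb{R}^{m\times m}$ is the mask restricting attention to the first $n$ columns. *)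

(* Defs.v *)
From mathcomp Require Import all_boot all_order all_algebra.
From mathcomp Require Import reals.

Set Implicit Arguments.
Unset Strict Implicit.
Unset Printing Implicit Defensive.

Import Order.TTheory GRing.Theory Num.Theory.
Local Open Scope ring_scope.

Lemma sum_head_dim (s h : nat) : (\sum_(i < h) s)%N = (s * h)%N.
Proof. by rewrite sum_nat_const card_ord mulnC. Qed.

(* The heads are stacked in order: row r of head i becomes row i * s + r. *)
Definition concat_heads (R : realType) (s h m : nat)
    (B : 'I_h -> 'M[R]_(s, m)) : 'M[R]_(s * h, m) :=
  castmx (sum_head_dim s h, erefl m) (\mxcol_(i < h) B i).

Definition attn_mask (R : realType) (n q : nat) : 'M[R]_(n + q) :=
  block_mx 1%:M 0 0 0.

(* The hidden dimension is written s * h, where s = d_hid / h is the dimension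
   of each of the h heads; divisibility by h is thus built in. *)
Record la_layer (R : realType) (s h : nat) := LALayer {
  WV : 'I_h -> 'M[R]_(s, s * h);
  WK : 'I_h -> 'M[R]_(s, s * h);
  WQ : 'I_h -> 'M[R]_(s, s * h);
  W1 : 'M[R]_(s * h)
}.

Definition la_head (R : realType) (s h n q : nat) (L : la_layer R s h)
    (H : 'M[R]_(s * h, n + q)) (i : 'I_h) : 'M[R]_(s, n + q) :=
  let V := WV L i *m H in
  let K := WK L i *m H in
  let Q := WQ L i *m H in
  V *m attn_mask R n q *m K^T *m Q.

Definition TF (R : realType) (s h n q : nat) (L : la_layer R s h)
    (H : 'M[R]_(s * h, n + q)) : 'M[R]_(s * h, n + q) :=
  W1 L *m (H + concat_heads (la_head L H)).

Definition columns (R : realType) (d m : nat) (x : 'I_m -> 'cV[R]_d) :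
    'M[R]_(d, m) :=
  \matrix_(j, k) x k j 0.

Definition label_row (R : realType) (n q : nat) (y : 'I_n -> R) :
    'rV[R]_(n + q) :=
  row_mx (\row_i y i) 0.

Definition input_mx (R : realType) (d n q : nat)
    (x : 'I_(n + q) -> 'cV[R]_d) (y : 'I_n -> R) : 'M[R]_(d + 1, n + q) :=
  col_mx (columns x) (label_row q y).

Definition rhat (R : realType) (d n q : nat)
    (x : 'I_(n + q) -> 'cV[R]_d) (y : 'I_n -> R) (j : 'I_d) : R :=
  n%:R^-1 * \sum_(i < n) x (lshift q i) j 0 * y i.

Definition Rhat (R : realType) (d n q : nat)
    (x : 'I_(n + q) -> 'cV[R]_d) (y : 'I_n -> R) : 'M[R]_d :=
  diag_mx (\row_j rhat x y j).

Lemma output_dim (d : nat) :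
  (0 < d)%N -> (d + 1 + (3 * d - (d + 1)) = 3 * d)%N.
Proof. by case: d => // d _; rewrite subnKC // mulSn leq_add2l mulnS. Qed.

(* Main.v *)
(** Give each head three rows of the hidden state: a zero row, the coordinate
    x_j and the label y. Head j uses x_j / n as value, y as key and x_j as query,
    all in its row 0, so that it writes r_j x_j on the zero row and leaves the two
    others unchanged; W_1 then selects the rows of the output. *)
Require Import Defs.
From mathcomp Require Import all_boot all_order all_algebra.
From mathcomp Require Import reals.

Set Implicit Arguments.
Unset Strict Implicit.
Unset Printing Implicit Defensive.

Import Order.TTheory GRing.Theory Num.Theory.
Local Open Scope ring_scope.

(** The index comes from [tagnat.Rank], the numbering behind [\mxcol], so entries of a stacked
    matrix are read off through [mxcolK] without any arithmetic on i * s + r. *)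
Definition head_row (s h : nat) (i : 'I_h) (r : 'I_s) : 'I_(s * h) :=
  cast_ord (sum_head_dim s h) (tagnat.Rank i r).

Lemma concat_headsE (R : realType) (s h m : nat) (B : 'I_h -> 'M[R]_(s, m))
    (i : 'I_h) (r : 'I_s) (k : 'I_m) :
  concat_heads B (head_row i r) k = B i r k.
Proof.
rewrite /concat_heads castmxE /= cast_ord_id cast_ordK.
by have /(congr1 (fun A : 'M[R]_(s, m) => A r k)) := mxcolK B i; rewrite mxE.
Qed.

Lemma mul_castmx_rows (R : realType) (m m' n p : nat) (e : m = m')
    (A : 'M[R]_(m, n)) (B : 'M[R]_(n, p)) :
  castmx (e, erefl n) A *m B = castmx (e, erefl p) (A *m B).
Proof. by case: m' / e; rewrite !castmx_id. Qed.

(** Each nonzero row of the embedding, weight and readout matrices below is a multiple of a basis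
    vector, so multiplying by it just selects and scales one row. *)
Lemma mul_rowdelta (R : realType) (m n p : nat) (A : 'M[R]_(m, n))
    (B : 'M[R]_(n, p)) (i : 'I_m) (a : 'I_n) (c : R) (k : 'I_p) :
  (forall b, A i b = c *+ (b == a)) -> (A *m B) i k = c * B a k.
Proof.
move=> Aia; rewrite mxE (bigD1 a) //= Aia eqxx big1 ?addr0 // => b /negPf ba.
by rewrite Aia ba mul0r.
Qed.

Lemma mul_row0 (R : realType) (m n p : nat) (A : 'M[R]_(m, n))
    (B : 'M[R]_(n, p)) (i : 'I_m) (k : 'I_p) :
  (forall b, A i b = 0) -> (A *m B) i k = 0.
Proof. by move=> Ai0; rewrite mxE big1 // => b _; rewrite Ai0 mul0r. Qed.

(** The mask zeroes the last [q] columns of [V], which leaves an inner product over the [n] labelled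
    columns. *)
Lemma attn_entry (R : realType) (s n q : nat) (V K : 'M[R]_(s, n + q))
    (a b : 'I_s) :
  (V *m attn_mask R n q *m K^T) a b =
  \sum_(i < n) V a (lshift q i) * K b (lshift q i).
Proof.
rewrite -[V]hsubmxK /attn_mask mul_row_block !mulmx1 !mulmx0 !addr0.
rewrite mxE big_split_ord /= [X in _ + X]big1 ?addr0 => [|i _]; last first.
  by rewrite row_mxEr mxE mul0r.
by apply: eq_bigr => i _; rewrite !row_mxEl !mxE.
Qed.

Section Construction.
Variables (R : realType) (d : nat).

Definition row_zero : 'I_3 := ord0.
Definition row_x : 'I_3 := inord 1.
Definition row_y : 'I_3 := inord 2.

(** [concat_heads] serves here only as a row layout: each head receives its own coordinate and its
    own copy of the label. *)
Definition embedding : 'M[R]_(3 * d, d + 1) :=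
  concat_heads (fun j : 'I_d =>
    delta_mx row_x (lshift 1 j) + delta_mx row_y (rshift d ord0)).

(** The label is present in every head, so it may be read from any one of them, [j0]. *)
Definition readout (j0 : 'I_d) (hd : (0 < d)%N) : 'M[R]_(3 * d) :=
  castmx (output_dim hd, erefl (3 * d)%N)
    (col_mx (col_mx (\matrix_(j < d) delta_mx 0 (head_row j row_zero))
                    (delta_mx 0 (head_row j0 row_y)))
            0).

Definition layer (n : nat) (j0 : 'I_d) (hd : (0 < d)%N) : la_layer R 3 d :=
  LALayer (fun j => n%:R^-1 *: delta_mx row_zero (head_row j row_x))
          (fun j => delta_mx row_zero (head_row j row_y))
          (fun j => delta_mx row_zero (head_row j row_x))
          (readout j0 hd).

Lemma embedding_zero m (E : 'M[R]_(d + 1, m)) j k :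
  (embedding *m E) (head_row j row_zero) k = 0.
Proof.
apply: mul_row0 => b; rewrite concat_headsE !mxE.
by rewrite -!val_eqE /= !inordK // addr0.
Qed.

Lemma embedding_x m (E : 'M[R]_(d + 1, m)) j k :
  (embedding *m E) (head_row j row_x) k = E (lshift 1 j) k.
Proof.
rewrite (@mul_rowdelta _ _ _ _ _ _ _ (lshift 1 j) 1) ?mul1r // => b.
by rewrite concat_headsE !mxE eqxx -(val_eqE row_x) /= !inordK // addr0.
Qed.

Lemma embedding_y m (E : 'M[R]_(d + 1, m)) j k :
  (embedding *m E) (head_row j row_y) k = E (rshift d ord0) k.
Proof.
rewrite (@mul_rowdelta _ _ _ _ _ _ _ (rshift d ord0) 1) ?mul1r // => b.
by rewrite concat_headsE !mxE eqxx -(val_eqE row_y) /= !inordK // add0r.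
Qed.

Lemma layer_head n q (j0 : 'I_d) hd (x : 'I_(n + q) -> 'cV[R]_d)
    (y : 'I_n -> R) j r k :
  la_head (layer n j0 hd) (embedding *m input_mx x y) j r k =
  (rhat x y j * x k j 0) *+ (r == row_zero).
Proof.
rewrite /la_head /=; set H := embedding *m _.
have [->|r0] := eqVneq r row_zero; last first.
  (* With [WV] as the leftmost factor, its zero rows make the whole product vanish outside row 0. *)
  rewrite mulr0n -!mulmxA; apply: mul_row0 => b.
  by rewrite !mxE (negPf r0) mulr0.
have Hx l : H (head_row j row_x) l = x l j 0.
  by rewrite embedding_x col_mxEu mxE.
have Hy i : H (head_row j row_y) (lshift q i) = y i.
  by rewrite embedding_y col_mxEd row_mxEl mxE.
(* Only row 0 of [WQ] is nonzero, so the product with the query reduces to the corner entry of V M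
   K^T times the row of x_j. *)
rewrite mulr1n mxE (bigD1 row_zero) //= big1 ?addr0 => [|b b0]; last first.
  rewrite [X in _ * X]mul_row0 ?mulr0 // => c.
  by rewrite !mxE (negPf b0).
rewrite attn_entry; congr (_ * _); last first.
  rewrite (@mul_rowdelta _ _ _ _ _ _ _ (head_row j row_x) 1) ?mul1r ?Hx // => b.
  by rewrite mxE eqxx.
(* The factor 1/n of [rhat] goes inside the sum, where [WV] supplies it in each term. *)
rewrite /rhat mulr_sumr; apply: eq_bigr => i _.
rewrite (@mul_rowdelta _ _ _ _ _ _ _ (head_row j row_x) n%:R^-1); last first.
  by move=> b; rewrite !mxE eqxx mulr_natr.
rewrite (@mul_rowdelta _ _ _ _ _ _ _ (head_row j row_y) 1); last first.
  by move=> b; rewrite mxE eqxx.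
by rewrite Hx Hy mul1r mulrA.
Qed.

End Construction.

Theorem proposition5p1 (R : realType) (d n q : nat)
    (hd : (0 < d)%N) (hn : (0 < n)%N) (hq : (0 < q)%N) :
  exists (WE : 'M[R]_(3 * d, d + 1)) (TF1 : la_layer R 3 d),
    forall (x : 'I_(n + q) -> 'cV[R]_d) (y : 'I_n -> R),
      exists star : 'M[R]_(3 * d - (d + 1), n + q),
        TF TF1 (WE *m input_mx x y) =
        castmx (output_dim hd, erefl (n + q)%N)
          (col_mx (col_mx (columns (fun k => Rhat x y *m x k))
                          (label_row q y))
                  star).
Proof.
pose j0 := Ordinal hd.
(* The free rows are 0 because the last rows of [readout] are. *)
exists (embedding R d), (layer R n j0 hd) => x y; exists 0.
rewrite /TF /= mul_castmx_rows !mul_col_mx mul0mx.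
congr (castmx _ (col_mx (col_mx _ _) _)); apply/matrixP => j k.
  rewrite (@mul_rowdelta _ _ _ _ _ _ _ (head_row j row_zero) 1); last first.
    by move=> b; rewrite !mxE.
  (* The residual term vanishes on this row, leaving exactly the attention output r_j x_kj. *)
  rewrite mxE embedding_zero concat_headsE layer_head eqxx.
  by rewrite mxE mul_diag_mx !mxE mul1r add0r.
rewrite (@mul_rowdelta _ _ _ _ _ _ _ (head_row j0 row_y) 1); last first.
  by move=> b; rewrite mxE ord1 eqxx.
(* Here the roles are reversed: attention adds nothing on the label row, and the residual term
   carries the labels through. *)
rewrite mxE embedding_y concat_headsE layer_head.
by rewrite -val_eqE /= inordK // mulr0n addr0 mul1r col_mxEd [j]ord1.
Qed.
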